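(* Let $(Y,\lambda)$ be a standard $\sigma$-finite space. The group $\mathrm{Aut}_f(Y,\lambda)$ cannot carry a Polish group topology, i.e. there is no Polish topology on $\mathrm{Aut}_f(Y,\lambda)$ which turns it into a topological group.
   Context: A standard $\sigma$-finite space is a standard Borel space equipped with a Borel nonatomic $\sigma$-finite infinite measure (all such spaces are isomorphic to $\mathbb R$ with the Lebesgue measure). $\mathrm{Aut}(Y,\lambda)$ is the group of all Borel bijections $T:Y\to Y$ such that $\lambda(T^{-1}(A))=\lambda(A)$ for all Borel $A\subseteq Y$, two such bijections being identified if they coincide on a conull set. The support of $T\in\mathrm{Aut}(Y,\lambda)$ is $\mathrm{supp}\,T=\{y\in Y: T(y)\neq y\}$, well-defined up to measure zero. $\mathrm{Aut}_f(Y,\lambda)$ is the normal subgroup of all $T\in\mathrm{Aut}(Y,\lambda)$ with $\lambda(\mathrm{supp}\,T)<+\infty$. *)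

(* Defs.v *)
From HB Require Import structures.
From mathcomp Require Import all_boot all_order all_algebra.
From mathcomp Require Import all_classical all_reals all_analysis.

Set Implicit Arguments.
Unset Strict Implicit.
Unset Printing Implicit Defensive.

Import Order.TTheory GRing.Theory Num.Theory.

Local Open Scope classical_set_scope.
Local Open Scope ring_scope.
Local Open Scope quotient_scope.

(* A topology on a fixed type [T], as a first-class value that can be
   quantified over; [topspace tau] is the type [T] carrying that topology. *)
Record topology (T : choiceType) := Topology {
  opens : set_system T ;
  opens_setT : opens setT ;
  opens_setI : setI_closed opens ;
  opens_bigcup : forall (I : Type) (f : I -> set T),
    (forall i, opens (f i)) -> opens (\bigcup_i f i)
}.

Definition topspace (T : choiceType) (tau : topology T) : Type := T.

Section topspace.
Context (T : choiceType) (tau : topology T).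

HB.instance Definition _ := Choice.on (topspace tau).
HB.instance Definition _ := isOpenTopological.Build (topspace tau)
  (@opens_setT _ tau) (@opens_setI _ tau) (@opens_bigcup _ tau).

Lemma open_topspace (A : set (topspace tau)) : open A = opens tau A.
Proof. by []. Qed.

End topspace.

Section polish.
Context (R : realType) (X : topologicalType).

Definition separable := exists2 D : set X, countable D & dense D.

Definition is_distance (dist : X -> X -> R) :=
  [/\ forall x y, 0 <= dist x y,
      forall x y, dist x y = 0 <-> x = y,
      forall x y, dist x y = dist y x
    & forall x y z, dist x z <= dist x y + dist y z].

Definition induces_topology (dist : X -> X -> R) := forall (x : X) (A : set X),
  nbhs x A <-> exists2 e : R, 0 < e & [set y | dist x y < e] `<=` A.

Definition cauchy_for (dist : X -> X -> R) (u : nat -> X) :=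
  forall e : R, 0 < e -> exists N, forall m n,
    (N <= m)%N -> (N <= n)%N -> dist (u m) (u n) < e.

Definition complete_distance (dist : X -> X -> R) := forall u : nat -> X,
  cauchy_for dist u -> exists l : X, u @ \oo --> l.

Definition polish := separable /\
  exists dist : X -> X -> R,
    [/\ is_distance dist, induces_topology dist & complete_distance dist].

End polish.

HB.mixin Record isStandardBorel (R : realType) d T of Measurable d T := {
  standard_borelP : exists tau : topology T,
    polish R (topspace tau) /\ (@measurable d T) = <<s opens tau >>
}.

#[short(type="standardBorelType")]
HB.structure Definition StandardBorel (R : realType) d :=
  {T of Measurable d T & isStandardBorel R d T}.

Definition nonatomic d (Y : measurableType d) (R : realType)
    (mu : {measure set Y -> \bar R}) :=
  forall A, measurable A -> (0 < mu A)%E ->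
    exists B, [/\ measurable B, B `<=` A, (0 < mu B)%E & (mu B < mu A)%E].

Section mpbij.
Context d (Y : measurableType d) (R : realType).
Variable lam : {measure set Y -> \bar R}.

(* The inverse of a Borel bijection of a standard Borel space is automatically
   Borel (Lusin-Souslin); for a general measurable space it has to be part of
   the data for these bijections to form a group. *)
Record mpbij := MPBij {
  mpbij_fun :> Y -> Y ;
  mpbij_inv : Y -> Y ;
  mpbijK : cancel mpbij_fun mpbij_inv ;
  mpbijVK : cancel mpbij_inv mpbij_fun ;
  measurable_mpbij : measurable_fun setT mpbij_fun ;
  measurable_mpbijV : measurable_fun setT mpbij_inv ;
  mpbij_preserving : forall A, measurable A -> lam (mpbij_fun @^-1` A) = lam A
}.

HB.instance Definition _ := gen_eqMixin mpbij.
HB.instance Definition _ := gen_choiceMixin mpbij.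

Implicit Types S T U : mpbij.

Lemma measurable_mpbij_preimage T A : measurable A -> measurable (T @^-1` A).
Proof. by move=> mA; rewrite -[X in measurable X]setTI; exact: measurable_mpbij. Qed.

Lemma measurable_mpbijV_preimage T A :
  measurable A -> measurable (mpbij_inv T @^-1` A).
Proof. by move=> mA; rewrite -[X in measurable X]setTI; exact: measurable_mpbijV. Qed.

Lemma mpbij_negligible T A : lam.-negligible A -> lam.-negligible (T @^-1` A).
Proof.
move=> [B [mB B0 AB]]; exists (T @^-1` B); split.
- exact: measurable_mpbij_preimage.
- by rewrite mpbij_preserving.
- by move=> x; exact: AB.
Qed.

Definition mpbij_one : mpbij.
Proof.
by refine (@MPBij id id _ _ _ _ _) => //; exact: measurable_id.
Defined.

Definition mpbij_inverse T : mpbij.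
Proof.
refine (@MPBij (mpbij_inv T) T (mpbijVK T) (@mpbijK T)
  (measurable_mpbijV T) (measurable_mpbij T) _) => A mA.
rewrite -(mpbij_preserving T); last exact: measurable_mpbijV_preimage.
by congr (lam _); apply/seteqP; split=> x /=; rewrite mpbijK.
Defined.

Definition mpbij_comp S T : mpbij.
Proof.
refine (@MPBij (S \o T) (mpbij_inv T \o mpbij_inv S) _ _ _ _ _).
- by move=> x /=; rewrite !mpbijK.
- by move=> x /=; rewrite !mpbijVK.
- by apply: measurableT_comp; exact: measurable_mpbij.
- by apply: measurableT_comp; exact: measurable_mpbijV.
- move=> A mA; rewrite comp_preimage mpbij_preserving ?mpbij_preserving//.
  exact: measurable_mpbij_preimage.
Defined.

Definition ae_same S T : bool := `[< {ae lam, forall y, S y = T y} >].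

Let ae_same_refl : reflexive ae_same.
Proof. by move=> T; apply/asboolP; exact: nearW. Qed.

Let ae_same_sym : symmetric ae_same.
Proof.
by move=> S T; apply/idP/idP => /asboolP h; apply/asboolP; apply: filterS h.
Qed.

Let ae_same_trans : transitive ae_same.
Proof.
move=> S T U /asboolP TS /asboolP SU; apply/asboolP.
by apply: filterS2 TS SU => y -> ->.
Qed.

Canonical ae_same_equiv :=
  EquivRel ae_same ae_same_refl ae_same_sym ae_same_trans.

Definition supp T : set Y := [set y | T y != y].

End mpbij.

(* Aut(Y, lam): identification is modulo almost-everywhere equality, and the
   product is composition, [S * T = S \o T]. *)
Definition Aut d (Y : measurableType d) (R : realType)
  (lam : {measure set Y -> \bar R}) : Type := {eq_quot (@ae_same d Y R lam)}.

Section Aut.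
Context d (Y : measurableType d) (R : realType).
Variable lam : {measure set Y -> \bar R}.
Implicit Types S T : mpbij lam.

HB.instance Definition _ := Choice.on (Aut lam).
HB.instance Definition _ := EqQuotient.on (Aut lam).

Lemma Aut_eqP S T :
  \pi_(Aut lam) S = \pi_(Aut lam) T <-> {ae lam, forall y, S y = T y}.
Proof.
by split=> [/eqmodP/asboolP//|ST]; apply/eqmodP/asboolP.
Qed.

Lemma Aut_pi (g : Aut lam) : exists T, g = \pi_(Aut lam) T.
Proof. by exists (repr g); rewrite reprK. Qed.

Lemma repr_Aut T : {ae lam, forall y, repr (\pi_(Aut lam) T) y = T y}.
Proof. by apply/Aut_eqP; rewrite reprK. Qed.

Lemma ae_mpbij (P : Y -> Prop) T :
  {ae lam, forall y, P y} -> {ae lam, forall y, P (T y)}.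
Proof. by move=> /(mpbij_negligible T). Qed.

Definition Aut_one : Aut lam := \pi_(Aut lam) (mpbij_one lam).
Definition Aut_mul (g h : Aut lam) : Aut lam :=
  \pi_(Aut lam) (mpbij_comp (repr g) (repr h)).
Definition Aut_inv (g : Aut lam) : Aut lam := \pi_(Aut lam) (mpbij_inverse (repr g)).

Lemma Aut_mulE S T :
  Aut_mul (\pi_(Aut lam) S) (\pi_(Aut lam) T) = \pi_(Aut lam) (mpbij_comp S T).
Proof.
apply/Aut_eqP => /=.
apply: filterS2 (repr_Aut T) (ae_mpbij T (repr_Aut S)) => y.
by move=> -> ->.
Qed.

Lemma Aut_invE T : Aut_inv (\pi_(Aut lam) T) = \pi_(Aut lam) (mpbij_inverse T).
Proof.
apply/Aut_eqP => /=.
apply: filterS (ae_mpbij (mpbij_inverse T) (repr_Aut T)) => y /=.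
by rewrite mpbijVK => h; rewrite -{1}h mpbijK.
Qed.

Let Aut_mulA : associative Aut_mul.
Proof.
move=> g h k; have [S ->] := Aut_pi g; have [T ->] := Aut_pi h.
have [U ->] := Aut_pi k; rewrite !Aut_mulE.
by apply/Aut_eqP; exact: nearW.
Qed.

Let Aut_mul1 : left_id Aut_one Aut_mul.
Proof.
move=> g; have [S ->] := Aut_pi g; rewrite Aut_mulE.
by apply/Aut_eqP; exact: nearW.
Qed.

Let Aut_1mul : right_id Aut_one Aut_mul.
Proof.
move=> g; have [S ->] := Aut_pi g; rewrite Aut_mulE.
by apply/Aut_eqP; exact: nearW.
Qed.

Let Aut_mulV : left_inverse Aut_one Aut_inv Aut_mul.
Proof.
move=> g; have [S ->] := Aut_pi g; rewrite Aut_invE Aut_mulE; apply/Aut_eqP.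
by apply: nearW => y /=; rewrite mpbijK.
Qed.

Let Aut_Vmul : right_inverse Aut_one Aut_inv Aut_mul.
Proof.
move=> g; have [S ->] := Aut_pi g; rewrite Aut_invE Aut_mulE; apply/Aut_eqP.
by apply: nearW => y /=; rewrite mpbijVK.
Qed.

HB.instance Definition _ := isGroup.Build (Aut lam)
  Aut_mulA Aut_mul1 Aut_1mul Aut_mulV Aut_Vmul.

End Aut.

Section Autf.
Context (R : realType) d (Y : standardBorelType R d).
Variable lam : {measure set Y -> \bar R}.
Implicit Types S T : mpbij lam.

Lemma measurable_supp T : measurable (supp T).
Proof.
have [tau [[[D cD dD] [dist [[d0 dE dC dT] dN _]]] mE]] :=
  @standard_borelP R d Y.
have mball q (e : R) : measurable [set y | dist q y < e].
  rewrite mE; apply: sub_gen_smallest; rewrite -open_topspace openE => y /= qy.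
  apply/dN; exists (e - dist q y); first by rewrite subr_gt0.
  by move=> z /=; rewrite ltrBrDl; apply: le_lt_trans; exact: dT.
have [D0|/unsquash q] := pfcard_geP cD.
  have /(dD setT) : [set: topspace tau] !=set0 by exists (point : Y).
  by move=> /(_ openT)[x [_]]; rewrite D0.
have -> : supp T = \bigcup_n \bigcup_k
    ([set y | dist (q k) y < n.+1%:R^-1] `\`
     (T @^-1` [set y | dist (q k) y < n.+1%:R^-1])).
  apply/seteqP; split=> [y /= /eqP Ty|y [n _ [k _ [/= ky]]]]; last first.
    by move=> kTy; apply/eqP => yE; apply: kTy; rewrite yE.
  have dy : 0 < dist y (T y).
    rewrite lt_neqAle d0 andbT eq_sym; apply/eqP => /dE yT.
    by apply: Ty; rewrite -yT.
  have [n ny] : exists n, n.+1%:R^-1 < dist y (T y) / 2.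
    have dy2 : 0 < dist y (T y) / 2 by rewrite divr_gt0.
    by have [n _ /(_ n (leqnn n))] := near_infty_natSinv_lt (PosNum dy2); exists n.
  have : [set z : topspace tau | dist z y < n.+1%:R^-1] !=set0.
    by exists y; rewrite /= (iffRL (dE y y) erefl) invr_gt0.
  move=> /dD; case.
    rewrite openE => z /= zy.
    apply/dN; exists (n.+1%:R^-1 - dist z y); first by rewrite subr_gt0.
    by move=> w /=; rewrite ltrBrDl (dC z w) addrC; apply: le_lt_trans; exact: dT.
  move=> x [/= xy Dx]; have [k _ kx] := 'surj_q Dx.
  exists n => //; exists k => //; split => /=; rewrite kx// => xTy.
  have := dT y x (T y); rewrite leNgt => /negP; apply.
  rewrite [ltRHS]splitr; apply: ltrD; last exact: lt_trans xTy ny.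
  by rewrite dC; exact: lt_trans xy ny.
apply: bigcup_measurable => n _; apply: bigcup_measurable => k _.
by apply: measurableD => //; exact: measurable_mpbij_preimage.
Qed.

Lemma lam_supp_le T A : measurable A ->
  {ae lam, forall y, T y <> y -> A y} -> (lam (supp T) <= lam A)%E.
Proof.
move=> mA [N [mN N0 TN]].
rewrite -(measureU0 mA mN N0); apply: le_measure; rewrite ?inE.
- exact: measurable_supp.
- exact: measurableU.
- move=> y /= /eqP Ty; have [Ay|nAy] := pselect (A y); [by left|right].
  by apply: TN => /= /(_ Ty).
Qed.

(* The support of a class is computed on a representative; by [finite_suppE]
   the choice of the representative is irrelevant. *)
Definition finite_supp : {pred Aut lam} :=
  fun g => (lam (supp (repr g)) < +oo)%E.

Lemma finite_suppE T :
  (\pi_(Aut lam) T \in finite_supp) = (lam (supp T) < +oo)%E.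
Proof.
rewrite unfold_in /finite_supp; congr (_ < _)%E.
by apply/eqP; rewrite eq_le; apply/andP; split; apply: lam_supp_le;
  (try exact: measurable_supp); apply: filterS (repr_Aut T) => y;
  rewrite /supp /= => -> /eqP.
Qed.

Lemma finite_supp_group_closed : group_closed finite_supp.
Proof.
split.
  rewrite -[1%g]/(\pi_(Aut lam) (mpbij_one lam)) finite_suppE.
  rewrite (_ : supp _ = set0) ?measure0//.
  by apply/seteqP; split=> y //; rewrite /supp /= eqxx.
move=> g h; have [S ->] := Aut_pi g; have [T ->] := Aut_pi h.
rewrite (finite_suppE S) (finite_suppE T) => fS fT.
suff : \pi_(Aut lam) (mpbij_comp S (mpbij_inverse T)) \in finite_supp.
  by rewrite -Aut_mulE -Aut_invE.
rewrite finite_suppE; apply: (@le_lt_trans _ _ (lam (supp S `|` supp T))).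
  apply: lam_supp_le; first by apply: measurableU; exact: measurable_supp.
  apply: nearW => y /= STy; apply/orP; apply: contra_notT STy.
  rewrite negb_or !negbK => /andP[/eqP Sy /eqP Ty].
  by rewrite -{1}Ty mpbijK Sy.
apply: le_lt_trans (measureU2 _ _ _) _; try exact: measurable_supp.
by rewrite lte_add_pinfty.
Qed.

End Autf.
Arguments finite_supp {R d Y} lam.

Definition Autf (R : realType) d (Y : standardBorelType R d)
  (lam : {measure set Y -> \bar R}) : Type :=
  {g : Aut lam | g \in finite_supp lam}.

Section Autf_group.
Context (R : realType) d (Y : standardBorelType R d).
Variable lam : {measure set Y -> \bar R}.

HB.instance Definition _ := SubChoice.on (Autf lam).
HB.instance Definition _ := SubChoice_isSubGroup.Build (Aut lam)
  (finite_supp lam) (Autf lam) (finite_supp_group_closed lam).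

End Autf_group.

Definition group_topology (G : groupType) (tau : topology G) :=
  continuous (fun p : topspace tau * topspace tau =>
                ((p.1 : G) * (p.2 : G))%g : topspace tau) /\
  continuous (fun g : topspace tau => ((g : G)^-1)%g : topspace tau).

(* Main.v *)
(* Fix disjoint sets [A k] of finite measure covering [Y].  By the
   isomorphism theorem for nonatomic measures (proved here up to half of the
   mass), [A k] contains [W k], of at least half its measure, carrying
   uncountably many measure-preserving bijections any two of which differ
   almost everywhere on [W k]: the reflections of a circle.  In a separable
   topological group two members of an uncountable family are as close as
   desired, so their quotient [s k], which moves almost every point of [W k],
   can be taken arbitrarily close to [1].  Choosing the [s k] inductively, the
   products [s 0 * ... * s k] form a Cauchy sequence for a given complete
   metric.  The elements trivial on [W k] are the centralizer of those
   supported in [W k], hence closed, so that the limit coincides with [s k] on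
   every [W k]; its support has infinite measure, a contradiction. *)
Require Import Defs.
From mathcomp Require Import all_boot all_order all_algebra.
From mathcomp Require Import all_classical all_reals all_analysis.
From mathcomp Require Import measurable_realfun lra.

Set Implicit Arguments.
Unset Strict Implicit.
Unset Printing Implicit Defensive.

Import Order.TTheory GRing.Theory Num.Theory.
Import numFieldNormedType.Exports.

Local Open Scope classical_set_scope.
Local Open Scope ring_scope.

(** * Borel coding of a standard Borel space *)

Lemma cvg_dist (R : realType) (X : topologicalType) (dist : X -> X -> R)
    (u : nat -> X) (l : X) (e : R) :
  induces_topology dist -> u @ \oo --> l -> 0 < e ->
  exists N, forall n, (N <= n)%N -> dist l (u n) < e.
Proof.
move=> dN ul e0; have : nbhs l [set y | dist l y < e] by apply/dN; exists e.
by move=> /ul[N _ NP]; exists N => n /NP.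
Qed.

(* Sequential form of: the image of [X] under the code map
   [x |-> (fun i => x \in U i)] is closed in the Cantor space. *)
Definition compact_for T (U : nat -> set T) (X : set T) :=
  forall z : nat -> bool,
    (forall n, exists2 x, X x & forall i, (i < n)%N -> (U i x <-> z i)) ->
  exists2 x, X x & forall i, U i x <-> z i.

(** Continuity from above: the sets [A]\[F j] have finite measure and decrease to the empty set. *)
Lemma approx_bigcup d (T : measurableType d) (R : realType)
    (mu : {measure set T -> \bar R}) (A : set T) (F : (set T)^nat) (e : R) :
  measurable A -> (mu A < +oo)%E -> (forall i, measurable (F i)) ->
  nondecreasing_seq F -> \bigcup_i F i = setT -> 0 < e ->
  exists j, (mu (A `\` F j) <= e%:E)%E.
Proof.
move=> mA Afin mF ndF FT e0; pose B i := A `\` F i.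
have mB i : measurable (B i) by exact: measurableD.
have B0 : \bigcap_i B i = set0.
  apply/seteqP; split=> // x Bx; have : setT x by [].
  by rewrite -FT => -[i _ Fx]; have [] := Bx i I.
have := @nonincreasing_cvg_mu _ _ _ mu B.
rewrite B0 measure0 => /(_ _ mB measurable0) /=.
have BA : (mu (B 0%N) < +oo)%E.
  apply: le_lt_trans Afin; apply: le_measure; rewrite ?inE//.
  by move=> x [].
have ndB : nonincreasing_seq B.
  by move=> i j ij; apply/subsetPset; apply: setDS; apply/subsetPset/ndF.
move=> /(_ BA ndB) cB.
have : \forall j \near \oo, (mu (B j) < e%:E)%E.
  have := cB; move/(_ [set x | (x < e%:E)%E]); apply.
  apply: open_nbhs_nbhs; split; first exact: open_ereal_lt_ereal.
  by rewrite /= lte_fin.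
by move=> [j _ /(_ j (leqnn j)) /= /ltW ?]; exists j.
Qed.

(** The sets [U i] are the balls of radius [r n] about a dense sequence. The last clause is a form
    of Ulam's tightness theorem: up to small measure, [A] lies in a set that is totally bounded and
    on which membership in each [U i] survives limits. *)
Lemma standard_borel_base (R : realType) d (Y : standardBorelType R d) :
  exists U : nat -> set Y,
  [/\ @measurable d Y = <<s range U >>,
      forall x y, (forall i, U i x <-> U i y) -> x = y
    & forall (mu : {measure set Y -> \bar R}) (A : set Y) (e : R),
        measurable A -> (mu A < +oo)%E -> 0 < e ->
      exists X, [/\ measurable X, (mu (A `\` X) <= e%:E)%E & compact_for U X]].
Proof.
have [tau [[[D cD dD] [dist [[d0 dE dC dT] dN dcomp]]] mE]] :=
  @standard_borelP R d Y.
have open_ball x (e : R) : opens tau [set y | dist x y < e].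
  rewrite -open_topspace openE => y /= xy.
  apply/dN; exists (e - dist x y); first by rewrite subr_gt0.
  by move=> z /=; rewrite ltrBrDl; apply: le_lt_trans; exact: dT.
have mball x (e : R) : measurable [set y | dist x y < e].
  by rewrite mE; apply: sub_gen_smallest; exact: open_ball.
have [D0|/unsquash q] := pfcard_geP cD.
  have /(dD setT) : [set: topspace tau] !=set0 by exists (point : Y).
  by move=> /(_ openT)[x [_]]; rewrite D0.
have [r [r0 ndr r_small]] : exists r : nat -> R, [/\ forall n, 0 < r n,
    forall m n, (m <= n)%N -> r n <= r m &
    forall e, 0 < e -> exists n, r n < e].
  exists (fun n => n.+1%:R^-1); split=> [n|m n mn|e e0].
  - by rewrite invr_gt0.
  - by rewrite lef_pV2 ?posrE// ler_nat.
  - have [n _ /(_ n (leqnn n))] := near_infty_natSinv_lt (PosNum e0).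
    by exists n.
pose B (p : nat * nat) : set Y := [set y | dist (q p.1) y < r p.2].
have dense_B y n : exists k, B (k, n) y.
  have /dD : [set z : topspace tau | dist y z < r n] !=set0.
    by exists y; rewrite /= (iffRL (dE y y) erefl).
  move=> /(_ (open_ball _ _))[x [/= xy Dx]]; have [k _ kx] := 'surj_q Dx.
  by exists k; rewrite /B /= kx dC.
have B_near O y : opens tau O -> O y -> exists2 p, B p y & B p `<=` O.
  rewrite -open_topspace openE => /(_ y) /[apply] /dN[e e0 eO].
  have [n ne] : exists n, r n < e / 2 by apply: r_small; lra.
  have [k ky] := dense_B y n; exists (k, n) => // z /= kz; apply: eO => /=.
  apply: le_lt_trans (dT y (q k) z) _; rewrite (dC y) [ltRHS]splitr.
  by apply: ltrD; apply: lt_trans ne.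
pose U i := B (odflt (0, 0)%N (unpickle i)).
have UB p : U (pickle p) = B p by rewrite /U pickleK.
have mB p : measurable (B p) by exact: mball.
exists U; split.
- rewrite mE; apply/seteqP; split; apply: smallest_sub.
  + exact: smallest_sigma_algebra.
  + move=> O oO.
    have -> : O = \bigcup_(i in [set i | U i `<=` O]) U i.
      apply/seteqP; split=> [y Oy|y [i /= iO /iO]//].
      have [p py pO] := B_near _ _ oO Oy; exists (pickle p).
        by rewrite /= UB.
      by rewrite UB.
    apply: (@bigcup_measurable _ (g_sigma_algebraType (range U)) U) => i _.
    by apply: sub_gen_smallest; exists i.
  + exact: smallest_sigma_algebra.
  + by move=> _ [i _ <-]; apply: sub_gen_smallest; exact: open_ball.
- move=> x y xy; apply/(dE x y); apply/eqP/negPn/negP => xy0.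
  have dxy : 0 < dist x y by rewrite lt_neqAle d0 andbT eq_sym.
  have [|p px pO] := B_near _ x (open_ball x (dist x y)).
    by rewrite /= (iffRL (dE x x) erefl).
  move: px; rewrite -UB => /xy; rewrite UB => /pO /=.
  by rewrite ltxx.

- move=> mu A e mA Afin e0.
  (* For fixed [i], these closed balls increase with [j] and exhaust the open ball [U i], since
     [r j] tends to [0]. *)
  pose Cl i j : set Y := let p := odflt (0, 0)%N (unpickle i) in
    [set y | dist (q p.1) y + r j <= r p.2].
  have ClU i j : Cl i j `<=` U i.
    move=> y; rewrite /Cl /U /B /=; apply: lt_le_trans.
    by rewrite ltrDl.
  have mU i : measurable (U i) by exact: mball.
  have mCl i j : measurable (Cl i j).
    rewrite /Cl; case: (odflt _ _) => k n /=.
    have -> : [set y | dist (q k) y + r j <= r n] =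
        \bigcap_l [set y | dist (q k) y < r n - r j + r l].
      apply/seteqP; split=> y /=; first by move=> yj l _ /=; have := r0 l; lra.
      move=> yl; rewrite leNgt; apply/negP => jy.
      have [|l lP] := r_small (dist (q k) y + r j - r n).
        by lra.
      by have /= := yl l I; lra.
    by apply: bigcapT_measurable => l; exact: mball.
  have ndCl i : nondecreasing_seq (Cl i).
    move=> j k jk; apply/subsetPset => y; rewrite /Cl /=.
    by apply: le_trans; rewrite lerD2l; exact: ndr.
  have UCl i : \bigcup_j Cl i j = U i.
    apply/seteqP; split=> [y [j _ /ClU]//|y]; rewrite /U /B /Cl /=.
    rewrite -subr_gt0 => /r_small[j yj]; exists j => //=.
    by move: yj; lra.
  have hC i : exists j, (mu (A `\` (Cl i j `|` ~` U i)) <=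
      ((e / 2) / (2 ^ i.+1)%:R)%:E)%E.
    apply: approx_bigcup => //.
    + by move=> j; apply: measurableU => //; exact: measurableC.
    + move=> j k jk; apply/subsetPset; apply: setSU; apply/subsetPset.
      exact: ndCl.
    + by rewrite bigcupUl ?UCl ?setUv//; exists 0%N.
    + by rewrite !divr_gt0// ltr0n expn_gt0.
  have hN n : exists N, (mu (A `\` \bigcup_(k < N) B (k, n)) <=
      ((e / 2) / (2 ^ n.+1)%:R)%:E)%E.
    apply: approx_bigcup => //.
    + by move=> j; exact: bigcup_measurable.
    + move=> j k jk; apply/subsetPset; apply: bigcup_subset => i /=.
      by move=> /leq_trans; exact.
    + apply/seteqP; split=> // y _; have [k ky] := dense_B y n.
      by exists k.+1 => //; exists k => //=.
    + by rewrite !divr_gt0// ltr0n expn_gt0.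
  have [c cP] := choice hC; have [N NP] := choice hN.
  (* The first factor pushes the points of [U i] into a closed subset of [U i]; the second gives
     total boundedness at scale [r i]. Each removes at most [(e / 2) / 2 ^ i.+1] from [A], which
     sums to [e]. *)
  pose E i := (Cl i (c i) `|` ~` U i) `&` \bigcup_(k < N i) B (k, i).
  have mE' i : measurable (E i).
    apply: measurableI; last exact: bigcup_measurable.
    by apply: measurableU => //; exact: measurableC.
  exists (\bigcap_i E i); split.
  + exact: bigcapT_measurable.
  + rewrite setDE setC_bigcap setI_bigcupr.
    apply: (le_trans (@measure_sigma_subadditive _ _ _ mu _ _ _ _ (@subset_refl _ _))).
    * by move=> i; rewrite -setDE; exact: measurableD.
    * by apply: bigcupT_measurable => i; rewrite -setDE; exact: measurableD.
    apply: le_trans (epsilon_trick0 xpredT (ltW e0)).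
    apply: lee_nneseries => // i _; rewrite /E setCI setIUr.
    apply: le_trans (measureU2 _ _ _) _; rewrite -?setDE.
    * by apply: measurableD => //; apply: measurableU => //; exact: measurableC.
    * by apply: measurableD => //; exact: bigcup_measurable.
    apply: le_trans (leeD (cP i) (NP i)) _.
    by rewrite -EFinD lee_fin -mulrDl -splitr.
  + move=> z zP.
    have [|x xP] := choice (_ : forall n, exists x, (\bigcap_i E i) x /\
        forall i, (i < n)%N -> U i x <-> z i).
      by move=> n; have [x ? ?] := zP n; exists x.
    have xz n i : (i < n)%N -> U i (x n) <-> z i by move=> /(xP n).2.
    have zk n : exists2 k, (k < N n)%N & z (pickle (k, n)).
      (* [M] exceeds the codes of all [N n] balls of radius [r n] covering the set, so [x M] agrees
         with [z] on each of them, and [z] selects the one containing [x M]. *)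
      pose M := (\max_(k < N n) pickle (k : nat, n)).+1.
      have [_ [k kN kx]] := (xP M).1 n I; exists k => //.
      apply/(xz M); last by rewrite UB.
      rewrite ltnS; exact: (@leq_bigmax _
        (fun k : 'I_(N n) => pickle (k : nat, n)) (Ordinal kN)).
    have xB n k m : z (pickle (k, n)) -> (pickle (k, n) < m)%N ->
        B (k, n) (x m).
      by move=> zkn km; rewrite -UB; apply/xz.
    have cauchy_x : cauchy_for (dist : topspace tau -> topspace tau -> R) x.
      move=> eps eps0.
      have [|n nP] := r_small (eps / 2); first by rewrite divr_gt0.
      (* From this index on, all terms lie in one ball of radius [r n], with [r n < eps / 2]. *)
      have [k _ zkn] := zk n; exists (pickle (k, n)).+1 => a b ka kb.
      apply: le_lt_trans (dT _ (q k) _) _; rewrite [ltRHS]splitr dC.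
      by apply: ltrD; apply: lt_trans nP; apply: xB.
    have [y xy] := dcomp _ cauchy_x.
    have zCl i : z i -> Cl i (c i) y.
      move=> zi; rewrite /Cl.
      set p := odflt _ _ => /=; rewrite leNgt; apply/negP => lty.
      (* If the limit were outside the closed ball, [e] would be its positive distance margin; but
         the terms [x m] with [m > i] belong to [U i], hence to the closed ball. *)
      have [|M MP] := cvg_dist (e := dist (q p.1) y + r (c i) - r p.2) dN xy.
        by lra.
      pose m := maxn M i.+1.
      have Uxm : U i (x m) by apply/xz => //; rewrite leq_max leqnn orbT.
      have [[Cxm|//] _] := (xP m).1 i I; rewrite /Cl -/p /= in Cxm.
      have := MP m (leq_maxl _ _); have := dT (q p.1) (x m) y.
      by rewrite (dC (x m) y); lra.
    have zU i : U i y <-> z i.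
      split=> [Uiy|/zCl/ClU//].
      have oU : nbhs (y : topspace tau) (U i).
        by apply: open_nbhs_nbhs; split => //; exact: open_ball.
      have [M _ MP] := xy _ oU.
      apply/(xz (maxn M i.+1)); first by rewrite leq_max leqnn orbT.
      by apply: MP => /=; rewrite leq_max leqnn.
    exists y => // i _; split.
      have [Uiy|] := pselect (U i y); last by right.
      by left; apply: zCl; apply/zU.
    by have [k kN /zU] := zk i; rewrite UB => kx; exists k.
Qed.

(** * Isomorphism with an interval *)

Section coding.
Context d (R : realType) (T : measurableType d).
Variables (U : nat -> set T) (X W : set T) (mu : {measure set T -> \bar R}).
Hypotheses (genU : @measurable d T = <<s range U >>)
  (sepU : forall x y, (forall i, U i x <-> U i y) -> x = y)
  (cX : compact_for U X) (mW : measurable W) (WX : W `<=` X)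
  (Wfin : (mu W < +oo)%E) (mu1 : forall x, mu [set x] = 0%E).

(* Words are read from right to left: the head of [s] is its last digit. *)
Fixpoint cyl (s : seq bool) : set T :=
  if s is b :: s' then cyl s' `&` (if b then U (size s') else ~` U (size s'))
  else setT.

Fixpoint prefix_of (z : nat -> bool) n : seq bool :=
  if n is n'.+1 then z n' :: prefix_of z n' else [::].

Lemma size_prefix_of z n : size (prefix_of z n) = n.
Proof. by elim: n => //= n ->. Qed.

Lemma cyl_prefixP z n y :
  cyl (prefix_of z n) y <-> forall i, (i < n)%N -> (U i y <-> z i).
Proof.
elim: n => [|n IHn] /=; first by split.
rewrite size_prefix_of; split=> [[/IHn zn zny] i|zn].
  rewrite ltnS leq_eqVlt => /predU1P[->|/zn//].
  by case: (z n) zny => //=; split.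
split; first by apply/IHn => i ni; apply: zn; rewrite ltnS ltnW.
by have := zn n (leqnn _); case: (z n) => -[h k] /=; [exact: k|move=> /h].
Qed.

Definition code y i := `[< U i y >].

Lemma cyl_code y n : cyl (prefix_of (code y) n) y.
Proof. by apply/cyl_prefixP => i _; split => /asboolP. Qed.

Lemma cylE s y : cyl s y <-> s = prefix_of (code y) (size s).
Proof.
split=> [|->]; last exact: cyl_code.
elim: s => //= b s IHs [/IHs <-]; rewrite /code.
by case: b => [/asboolP ->|?] //; congr cons; apply/esym/asboolPn.
Qed.

Lemma measurable_U i : measurable (U i).
Proof. by rewrite genU; apply: sub_gen_smallest; exists i. Qed.

Lemma measurable_cyl s : measurable (cyl s).
Proof.
elim: s => [|b s IHs] /=; first exact: measurableT.
apply: measurableI => //; case: b; first exact: measurable_U.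
exact/measurableC/measurable_U.
Qed.
Local Hint Resolve measurable_cyl : core.

(** A generating system closed under intersection, on which measures can be compared; two cylinders
    are nested or disjoint, whence the empty set. *)
Definition cylinders : set (set T) := [set B | B = set0 \/ exists s, B = cyl s].

Lemma cylinders_setI : setI_closed cylinders.
Proof.
move=> _ _ [->|[s ->]] [->|[t ->]]; rewrite ?setI0 ?set0I; try by left.
have [st|/nonemptyPn st] := pselect ((cyl s `&` cyl t) !=set0); last by left.
case: st => y [/cylE -> /cylE ->]; right.
exists (prefix_of (code y) (maxn (size s) (size t))).
apply/seteqP; split=> x; rewrite /= !cyl_prefixP.
  by move=> [xs xt] i; rewrite leq_max => /orP[/xs|/xt].
by move=> xst; split=> i ?; apply: xst; rewrite leq_max; apply/orP; [left|right].
Qed.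

Lemma cylinders_gen : @measurable d T = <<s cylinders >>.
Proof.
rewrite genU; apply/seteqP; split; apply: smallest_sub => //; last first.
  move=> _ [->|[s ->]]; first exact: sigma_algebra0.
  by rewrite -genU.
move=> _ [i _ <-].
(* [U i] is the union of the finitely many cylinders of length [i.+1] whose last digit is [true];
   words [s] of other lengths contribute the empty set. *)
have -> : U i = \bigcup_s (if size s == i then cyl (true :: s) else set0).
  apply/seteqP; split=> [y Uy|y [s _]]; last by case: eqP => // <- [].
  exists (prefix_of (code y) i) => //.
  by rewrite size_prefix_of eqxx /= size_prefix_of; split=> //; exact: cyl_code.
apply: (@countable_bigcupT_measurable _ (g_sigma_algebraType cylinders)).
  exact: countableP.
move=> s; case: eqP => _; last exact: measurable0.
by apply: sub_gen_smallest; right; exists (true :: s).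
Qed.

(** * Nested intervals as long as the cylinders are heavy *)

Definition wt A : R := fine (mu (W `&` A)).

Lemma wtE A : measurable A -> mu (W `&` A) = (wt A)%:E.
Proof.
move=> mA; rewrite fineK// ge0_fin_numE//; apply: le_lt_trans Wfin.
by apply: le_measure; rewrite ?inE//; exact: measurableI.
Qed.

Lemma wt_ge0 A : 0 <= wt A. Proof. by rewrite fine_ge0. Qed.
Local Hint Resolve wt_ge0 : core.

Lemma wt_split s : wt (cyl s) = wt (cyl (false :: s)) + wt (cyl (true :: s)).
Proof.
apply: EFin_inj; rewrite EFinD -!wtE// -measureU//; try exact: measurableI.
  by congr (mu _); rewrite -setIUr /= -setIUr setvU setIT.
by apply/seteqP; split=> // y [[_ [_ nU]] [_ [_ /nU]]].
Qed.

(** The mass in [W] of the cylinders of the same length that precede [s] lexicographically; thus the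
    intervals [[lo s, lo s + wt (cyl s)[] of a given length tile [[0, mass[] in lexicographic
    order. *)
Fixpoint lo (s : seq bool) : R :=
  if s is b :: s' then lo s' + (if b then wt (cyl (false :: s')) else 0) else 0.

Definition mass := wt setT.

Lemma massE : mu W = mass%:E.
Proof. by rewrite -wtE// setIT. Qed.

Definition itv s : set R := `[lo s, lo s + wt (cyl s)[%classic.

Lemma lo_ge0 s : 0 <= lo s.
Proof. by elim: s => [|[] s IHs] //=; rewrite addr_ge0. Qed.

Lemma hi_le s : lo s + wt (cyl s) <= mass.
Proof.
elim: s => [|b s]; first by rewrite /= add0r.
apply: le_trans; rewrite [wt (cyl s)]wt_split.
by have := wt_ge0 (cyl (true :: s)); case: b => h; rewrite [lo (_ :: _)]/=; lra.
Qed.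

Definition dom : set R := `[0, mass[%classic.

Lemma itv_dom s : itv s `<=` dom.
Proof.
move=> u; rewrite /itv /dom /= !in_itv /= => /andP[su us].
by rewrite (le_trans (lo_ge0 s) su) (lt_le_trans us)// hi_le.
Qed.

(** A generalized binary expansion: each digit tells which of the two subintervals of the current
    interval contains [u]. *)
Fixpoint address (u : R) n : seq bool :=
  if n is n'.+1 then
    (lo (address u n') + wt (cyl (false :: address u n')) <= u) :: address u n'
  else [::].

Lemma itv_address u n : dom u -> itv (address u n) u.
Proof.
move=> du; elim: n => [|n]; first by rewrite /itv /= add0r.
rewrite /itv /= !in_itv /= => /andP[su us].
case: ifPn => [->/=|]; first by move: us; rewrite wt_split /=; lra.
by rewrite -ltNge addr0 su => ->.
Qed.

Lemma itv_addressE s u : itv s u -> s = address u (size s).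
Proof.
elim: s => //= b s IHs su; have su' : itv s u.
  move: su; rewrite /itv /= !in_itv /= [wt (cyl s)]wt_split /=.
  have := wt_ge0 (cyl (false :: s)); have := wt_ge0 (cyl (true :: s)) => /=.
  by case: b => /= ? ? /andP[]; rewrite ?addr0; lra.
rewrite -(IHs su'); congr cons; move: su; rewrite /itv /= in_itv /=.
case: b => /= /andP[h k]; first by rewrite h.
by apply/esym/negbTE; rewrite -ltNge; move: k; rewrite addr0.
Qed.

Lemma itvE s u : dom u -> itv s u <-> s = address u (size s).
Proof. by move=> du; split=> [/itv_addressE//|->]; exact: itv_address. Qed.

Lemma address_prefix u n :
  address u n = prefix_of (fun i => head false (address u i.+1)) n.
Proof. by elim: n => //= n ->. Qed.


(** The condition [dom u] stands under the existential so that choice yields a total function. *)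
Lemma decode u : exists y, dom u -> forall s, cyl s y <-> itv s u.
Proof.
have [du|ndu] := pselect (dom u); last by exists point.
pose z i := head false (address u i.+1).
(* An interval containing [u] is nonempty, so its cylinder has positive mass and meets [W]. Every
   finite part of the address is therefore realized in [X], and [cX] realizes the whole of it. *)
have [|y _ yz] := cX (z := z).
  move=> n; have [y [Wy ny]] : W `&` cyl (prefix_of z n) !=set0.
    apply/set0P/eqP => W0; have := itv_address n du.
    rewrite (address_prefix u n) -/z /itv /= in_itv /= /wt W0 measure0 /=.
    by rewrite addr0 leNgt => /andP[/negP].
  by exists y; [exact: WX|exact/cyl_prefixP].
have zE : z = code y by apply/funext => i; apply/idP/asboolP => /yz.
exists y => _ s; rewrite cylE itvE// address_prefix -/z.
by rewrite zE.
Qed.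

Definition decoding : R -> T := projT1 (choice decode).

Lemma decodingP u s : dom u -> cyl s (decoding u) <-> itv s u.
Proof. by rewrite /decoding; case: (choice _) => f /= fP /fP. Qed.

Lemma decoding_preimage s : dom `&` decoding @^-1` cyl s = itv s.
Proof.
apply/seteqP; split=> [u [du /decodingP]|u su]; first exact.
have du := itv_dom su; split=> //=; exact/decodingP.
Qed.

Lemma measurable_decoding : measurable_fun dom decoding.
Proof.
apply: (measurability cylinders cylinders_gen) => _ [_ [->|[s ->]] <-].
  by rewrite preimage_set0 setI0; exact: measurable0.
by rewrite decoding_preimage; exact: measurable_itv.
Qed.

(** The cylinders around [y] decrease to [[set y]], because [U] separates points, and points are
    null. *)
Lemma cvg_wt_code y : wt (cyl (prefix_of (code y) n)) @[n --> \oo] --> 0.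
Proof.
pose B n := W `&` cyl (prefix_of (code y) n).
have mB n : measurable (B n) by exact: measurableI.
have BE : \bigcap_n cyl (prefix_of (code y) n) = [set y].
  apply/seteqP; split=> [x xy|_ -> n _]; last exact: cyl_code.
  apply: sepU => i; have /cyl_prefixP/(_ i (leqnn _)) := xy i.+1 I.
  by move=> ->; split=> [/asboolP|?]; last exact/asboolP.
have my : measurable [set y] by rewrite -BE; exact: bigcapT_measurable.
have mBI : measurable (\bigcap_n B n) by exact: bigcapT_measurable.
have B0 : mu (\bigcap_n B n) = 0%E.
  apply: (subset_measure0 mBI my) (mu1 y).
  by rewrite -BE => x Bx n nI; have [] := Bx n nI.
suff : mu (B n) @[n --> \oo] --> 0%E by move=> /fine_cvg.
rewrite -B0; apply: nonincreasing_cvg_mu => //.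
  by apply: le_lt_trans Wfin; apply: le_measure; rewrite ?inE// => x [].
move=> m n mn; apply/subsetPset; apply: setIS => x /cyl_prefixP xn.
by apply/cyl_prefixP => i im; apply: xn; exact: leq_trans mn.
Qed.

(** The distribution function of the measure on [W] for the lexicographic order of codes. *)
Definition coding y : R := limn (fun n => lo (prefix_of (code y) n)).

Lemma cvg_coding y : lo (prefix_of (code y) n) @[n --> \oo] --> coding y.
Proof.
apply: nondecreasing_is_cvgn.
  apply/nondecreasing_seqP => n /=; rewrite lerDl.
  by case: ifP => // _; exact: wt_ge0.
exists mass => _ [n _ <-]; apply: le_trans (hi_le (prefix_of (code y) n)).
by rewrite lerDl wt_ge0.
Qed.

Lemma measurable_coding : measurable_fun setT coding.
Proof.
apply: (measurable_fun_cvg (h := fun n y => lo (prefix_of (code y) n)));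
  last by move=> y _; exact: cvg_coding.
move=> n _ B mB; rewrite setTI.
(* The [n]-th approximation depends only on the first [n] digits, so its preimages are countable
   unions of cylinders. *)
rewrite (_ : _ @^-1` B = \bigcup_s
    (if `[< size s = n /\ B (lo s) >] then cyl s else set0)).
  apply: countable_bigcupT_measurable; first exact: countableP.
  by move=> s; case: ifP.
apply/seteqP; split=> [y By|y [s _]].
  exists (prefix_of (code y) n) => //; rewrite size_prefix_of.
  by rewrite asboolT//; exact: cyl_code.
by case: asboolP => // -[<- Bs] /cylE sE /=; rewrite -sE.
Qed.

(** Squeeze: the left endpoint of the [n]-th interval around [u] differs from [u] by at most its
    length, which tends to [0]. *)
Lemma coding_decoded y u : (forall s, cyl s y <-> itv s u) -> coding y = u.
Proof.
move=> yu; have c := @cvg_coding y; have w := @cvg_wt_code y.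
apply: (cvg_unique _ c); first exact: norm_hausdorff.
have cu : (fun n => u - wt (cyl (prefix_of (code y) n))) @ \oo --> u.
  by rewrite -[X in _ --> X]subr0; apply: cvgB => //; exact: cvg_cst.
apply: (squeeze_cvgr _ cu (cvg_cst u)); apply: nearW => n.
have /yu := cyl_code y n; rewrite /itv /= in_itv /= => /andP[-> /ltW].
by rewrite lerBlDr => ->.
Qed.

(** [coding] may collapse null cylinders; this is the set on which it is inverse to [decoding]. *)
Definition coded : set T :=
  [set y | dom (coding y) /\ forall s, cyl s y <-> itv s (coding y)].

Lemma measurable_coded : measurable coded.
Proof.
have mc A : measurable A -> measurable (coding @^-1` A).
  by move=> mA; rewrite -[X in measurable X]setTI; exact: measurable_coding.
have -> : coded = coding @^-1` dom `&` ~` \bigcup_s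
    ((cyl s `&` ~` (coding @^-1` itv s)) `|` (~` cyl s `&` coding @^-1` itv s)).
  apply/seteqP; split=> [y [dy yP]|y [dy ny]]; split=> //.
    by move=> [s _ [[/yP]|[+ /yP]]].
  move=> s; split=> ys; apply: contrapT => yns; apply: ny; exists s => //.
    by left.
  by right.
have mi s : measurable (coding @^-1` itv s) by apply: mc; exact: measurable_itv.
apply: measurableI; first by apply: mc; exact: measurable_itv.
apply: measurableC; apply: countable_bigcupT_measurable.
  exact: countableP.
by move=> s; apply: measurableU; apply: measurableI => //; exact: measurableC.
Qed.

Lemma decodingK u : dom u -> coding (decoding u) = u.
Proof. by move=> du; apply: coding_decoded => s; exact: decodingP. Qed.

Lemma decoding_coded u : dom u -> coded (decoding u).
Proof. by move=> du; split; rewrite decodingK// => s; exact: decodingP. Qed.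

Lemma codingK y : coded y -> decoding (coding y) = y.
Proof.
move=> [dy yP]; apply: sepU => i.
have H s : cyl s (decoding (coding y)) <-> cyl s y.
  by split=> [/(decodingP _ dy)/yP|/yP/(decodingP _ dy)].
have := cyl_code (decoding (coding y)) i.+1.
rewrite H cylE size_prefix_of => -[+ _]; exact: asbool_eq_equiv.
Qed.

(** Both sides are finite measures in [A], and on [cyl s] both equal the length of [itv s]. *)
Lemma lebesgue_decoding A : measurable A ->
  lebesgue_measure (dom `&` decoding @^-1` A) = mu (W `&` A).
Proof.
(* The constant value outside [dom] makes the map measurable on the whole line, as a pushforward
   requires. *)
pose g u := if u \in dom then decoding u else decoding 0.
have mdom : measurable dom by exact: measurable_itv.
have mg : measurable_fun setT g.
  have pT : (fun u => u \in dom) @^-1` [set true] = dom.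
    by apply/seteqP; split=> u /=; [exact: set_mem|exact: mem_set].
  apply: measurable_fun_if => //.
  - by apply: (measurable_fun_bool true); rewrite setTI pT.
  - by rewrite setTI pT; exact: measurable_decoding.
(* [push] abstracts over the proof that [g] is measurable. *)
pose push : {measure set T -> \bar R} :=
  pushforward (mrestr (@lebesgue_measure R) mdom) g.
pose m1 := push mg.
pose m2 : {measure set T -> \bar R} := mrestr mu mW.
have domg B : g @^-1` B `&` dom = dom `&` decoding @^-1` B.
  by rewrite setIC; apply/seteqP; split=> u [du]; split=> //;
    move: b; rewrite /g /= mem_set.
move=> mA; suff : m1 A = m2 A.
  by rewrite /m1 /m2/= /pushforward /mrestr domg [A `&` W]setIC.
apply: (measure_unique cylinders (fun=> setT) cylinders_gen cylinders_setI)
  => //.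
- by move=> _; right; exists [::].
- by rewrite bigcup_const//; exists 0%N.
- move=> _ [->|[s ->]]; rewrite ?measure0//.
  rewrite /m1 /m2/= /pushforward /mrestr domg decoding_preimage.
  rewrite [in RHS]setIC wtE//.
  rewrite lebesgue_measure_itv /= lte_fin ltrDl lt_neqAle wt_ge0 andbT.
  by case: eqP => [<-//|_]; rewrite -EFinB addrAC subrr add0r.
- move=> _; rewrite /m2 /m1/= /pushforward /mrestr domg preimage_setT setIT.
  by rewrite lebesgue_measure_itv /=; case: ifP => // _; rewrite -EFinB ltry.
Qed.

(** Two sets are kept apart: the bijection with [dom] is exact on [V], while the measure transported
    to [dom] is that of [W]. *)
Lemma interval_coding : exists (g : R -> T) (c : T -> R) (V : set T),
  [/\ measurable V, measurable_fun setT c & measurable_fun dom g] /\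
  [/\ forall u, dom u -> V (g u) /\ c (g u) = u,
      forall y, V y -> dom (c y) /\ g (c y) = y
    & forall A, measurable A ->
        lebesgue_measure (dom `&` g @^-1` A) = mu (W `&` A)].
Proof.
exists decoding, coding, coded; split; split.
- exact: measurable_coded.
- exact: measurable_coding.
- exact: measurable_decoding.
- by move=> u du; split; [exact: decoding_coded|exact: decodingK].
- by move=> y cy; split; [case: cy|exact: codingK].
- exact: lebesgue_decoding.
Qed.

End coding.

(** * Reflections of a circle *)

Section reflections.
Context (R : realType) (m : R).
Implicit Types (t u : R) (A B : set R).

Lemma lebesgue_measure_reflect (c : R) B : measurable B ->
  lebesgue_measure ((fun x => c - x) @^-1` B) = lebesgue_measure B.
Proof.
move=> mB; have mf : @measurable_fun _ _ (measurableTypeR R) (measurableTypeR R)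
    setT (fun x => c - x).
  by apply: measurable_funB => //; exact: measurable_id.
pose push : {measure set (measurableTypeR R) -> \bar R} :=
  pushforward (@lebesgue_measure R)
    (fun x : measurableTypeR R => c - x : measurableTypeR R).
pose nu := push mf.
suff : lebesgue_measure B = nu B by [].
apply: lebesgue_measure_unique => // _ [[a b] _ <-] /=.
rewrite /pushforward.
have -> : (fun x => c - x) @^-1` [set` `]a, b]] = [set` `[c - b, c - a[].
  apply/seteqP; split=> x; rewrite /= !in_itv /= => /andP[h k]; lra.
rewrite !lebesgue_measure_itv /= !lte_fin ltrD2l ltrN2; case: ifP => // _.
by rewrite -!EFinB; congr EFin; lra.
Qed.

(* Reflects each of the two arcs [[0, t]] and [[t, m]] about its midpoint; on
   the circle [[0, m]] this is the reflection [u |-> t - u] modulo [m]. *)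
Definition refl t u : R :=
  if 0 < u < t then t - u else if t < u < m then m + t - u else u.

Lemma reflK t : involutive (refl t).
Proof.
move=> u; rewrite [refl t u]/refl; case: ifPn => [ut|nut].
  by rewrite /refl (_ : 0 < t - u < t) /=; lra.
case: ifPn => [um|num]; last by rewrite /refl (negbTE nut) (negbTE num).
rewrite /refl (_ : (0 < m + t - u < t) = false); last by apply/negbTE; lra.
by rewrite (_ : t < m + t - u < m) /=; lra.
Qed.

Lemma measurable_refl t : measurable_fun setT (refl t).
Proof.
have mI (a b : R) : measurable_fun setT (fun u : R => a < u < b).
  by apply: measurable_and; apply: measurable_fun_ltr.
apply: measurable_fun_ifT; [exact: mI|exact: measurable_funB|].
by apply: measurable_fun_ifT; [exact: mI|exact: measurable_funB|].
Qed.

(** Away from the arc endpoints, [u + refl t u] is congruent to [t] modulo [m], and [t] lies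
    strictly between [0] and [m]. *)
Lemma refl_inj_l u t t' : 0 < t < m -> 0 < t' < m -> 0 < u < m ->
  u != t -> u != t' -> refl t u = refl t' u -> t = t'.
Proof.
move=> t0 t'0 u0; rewrite !neq_lt /refl.
by case/orP => h1 /orP[] h2; case: ifPn => h3; case: ifPn => h4;
  try (case: ifPn => h5); try (case: ifPn => h6); lra.
Qed.

Local Notation dom := (`[0, m[%classic : set R).

Lemma refl_dom t u : 0 < t < m -> dom u -> dom (refl t u).
Proof.
move=> t0; rewrite /= !in_itv /= /refl => u0.
by case: ifPn => h1; [|case: ifPn => h2]; lra.
Qed.

Lemma refl_neq t u : 0 < t < m -> 0 < u < m -> u != t ->
  0 < refl t u < m /\ refl t u != t.
Proof.
move=> t0 u0; rewrite !neq_lt /refl => /orP[] h.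
  by rewrite (_ : 0 < u < t) /=; [split; [|apply/orP; left]|]; lra.
rewrite (_ : 0 < u < t = false); last by apply/negbTE; lra.
by rewrite (_ : t < u < m) /=; [split; [|apply/orP; right]|]; lra.
Qed.

(** Up to the null set of endpoints, [dom] is the union of two open arcs, and on each of them
    [refl t] is a reflection of the line. *)
Lemma lebesgue_measure_refl t B : 0 < t < m -> measurable B ->
  lebesgue_measure (dom `&` refl t @^-1` B) = lebesgue_measure (dom `&` B).
Proof.
move=> t0 mB.
pose I1 : set R := `]0, t[%classic; pose I2 : set R := `]t, m[%classic.
have mI1 : measurable I1 by exact: measurable_itv.
have mI2 : measurable I2 by exact: measurable_itv.
have split_dom A : measurable A ->
    lebesgue_measure (dom `&` A) =
    (lebesgue_measure (I1 `&` A) + lebesgue_measure (I2 `&` A))%E.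
  move=> mA; pose E := [set 0; t] `&` A.
  have mE : measurable E by apply: measurableI => //; exact: measurableU.
  have E0 : lebesgue_measure E = 0%E.
    apply: countable_lebesgue_measure0; apply: finite_set_countable.
    exact/finite_setIl/finite_set2.
  rewrite -measureU; try exact: measurableI; last first.
    apply/seteqP; split=> // u [[+ _] [+ _]].
    by rewrite /I1 /I2 /= !in_itv /=; lra.
  rewrite -[RHS](@measureU0 _ _ _ (@lebesgue_measure R) _ E); first last.
  - exact: E0.
  - exact: mE.
  - by apply: measurableU; exact: measurableI.
  congr lebesgue_measure; apply/seteqP.
  split=> u; rewrite /E /I1 /I2 /= !in_itv /=.
    move=> [u0 Au].
    have [uE|u0'] := eqVneq u 0; first by right; split=> //; left.
    have [uE|ut] := eqVneq u t; first by right; split=> //; right.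
    left; move: u0' ut; rewrite !neq_lt => /orP[h1|h1] /orP[h2|h2].
    - by exfalso; lra.
    - by exfalso; lra.
    - by left; split=> //; lra.
    - by right; split=> //; lra.
  by move=> [[] [] h Au|[[] -> Au]]; split=> //; lra.
have mrB : measurable (refl t @^-1` B).
  by rewrite -[X in measurable X]setTI; exact: measurable_refl.
rewrite !split_dom//; congr (_ + _)%E.
  rewrite -(lebesgue_measure_reflect t (measurableI _ _ mI1 mB)).
  congr lebesgue_measure; apply/seteqP; split=> u; rewrite /I1 /= !in_itv /= /refl.
    by move=> [h]; rewrite h /= => k; split=> //; lra.
  by move=> [h k]; rewrite (_ : 0 < u < t) /=; [split=> //|]; lra.
rewrite -(lebesgue_measure_reflect (m + t) (measurableI _ _ mI2 mB)).
congr lebesgue_measure; apply/seteqP; split=> u; rewrite /I2 /= !in_itv /= /refl.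
  move=> [h]; rewrite (_ : 0 < u < t = false); last by apply/negbTE; lra.
  by rewrite h /= => k; split=> //; lra.
move=> [h k]; rewrite (_ : 0 < u < t = false); last by apply/negbTE; lra.
by rewrite (_ : t < u < m) /=; [split=> //|]; lra.
Qed.

End reflections.

(** * Uncountable families of measure-preserving bijections *)

Section reflection_family.
Context d (R : realType) (T : measurableType d).
Variables (mu : {measure set T -> \bar R}) (W V : set T).
Variables (m : R) (g : R -> T) (c : T -> R).
Local Notation dom := (`[0, m[%classic : set R).
Hypotheses (mW : measurable W) (mV : measurable V) (mc : measurable_fun setT c)
  (mg : measurable_fun dom g)
  (gK : forall u, dom u -> V (g u) /\ c (g u) = u)
  (cK : forall y, V y -> dom (c y) /\ g (c y) = y)
  (lebg : forall A, measurable A ->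
     lebesgue_measure (dom `&` g @^-1` A) = mu (W `&` A)).

Section fixed_parameter.
Variable t : R.
Hypothesis t0 : 0 < t < m.

Let mdom : measurable dom. Proof. exact: measurable_itv. Qed.

Let mcA A : measurable A -> measurable (c @^-1` A).
Proof. by move=> mA; rewrite -[X in measurable X]setTI; exact: mc. Qed.

Let mrA A : measurable A -> measurable (refl m t @^-1` A).
Proof.
by move=> mA; rewrite -[X in measurable X]setTI; exact: measurable_refl.
Qed.

(* The endpoints of the arcs, which [refl] fixes, are removed. *)
Definition good_param : set R := [set u | [/\ 0 < u < m, u != t,
  W (g u) & W (g (refl m t u))]].

Lemma good_param_dom u : good_param u -> dom u.
Proof. by move=> [/andP[/ltW u0 um] _ _ _]; rewrite /= in_itv /= u0. Qed.

Lemma good_param_refl u : good_param u -> good_param (refl m t u).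
Proof.
move=> [u0 ut Wu Wru]; have [ru0 rut] := refl_neq t0 u0 ut.
by split=> //; rewrite reflK.
Qed.

Lemma measurable_good_param : measurable good_param.
Proof.
have -> : good_param = (`]0, m[%classic `\ t) `&`
    (dom `&` g @^-1` W) `&` (refl m t @^-1` (dom `&` g @^-1` W)).
  apply/seteqP; split=> u.
    move=> [u0 ut Wu Wru]; have [/andP[r0 rm] _] := refl_neq t0 u0 ut.
    have /andP[u00 um] := u0.
    by split; [split|]; split; rewrite //= ?in_itv /= ?u00 ?um ?(ltW u00)
      ?(ltW r0) ?rm//; exact/eqP.
  by rewrite /= !in_itv /= => -[[[u0 /eqP ut] [_ Wu]] [_ Wru]].
apply: measurableI; last by apply: mrA; exact: mg.
apply: measurableI; last exact: mg.
by apply: measurableD => //; exact: measurable_itv.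
Qed.

Definition good_point : set T := V `&` c @^-1` good_param.

Lemma measurable_good_point : measurable good_point.
Proof.
by apply: measurableI => //; apply: mcA; exact: measurable_good_param.
Qed.

Lemma good_point_sub : good_point `<=` W.
Proof. by move=> y [Vy [_ _ + _]]; rewrite (cK Vy).2. Qed.

Definition reflect_fun y := if y \in good_point then g (refl m t (c y)) else y.

Lemma reflect_good y : good_point y -> good_point (reflect_fun y).
Proof.
move=> Gy; have [Vy /good_param_refl cy] := Gy; rewrite /reflect_fun mem_set//.
have [Vg cg] := gK (good_param_dom cy).
by split=> //=; rewrite cg.
Qed.

Lemma reflect_id y : ~ W y -> reflect_fun y = y.
Proof. by move=> nWy; rewrite /reflect_fun memNset// => /good_point_sub. Qed.

Lemma reflect_funK : involutive reflect_fun.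
Proof.
move=> y; have [Gy|nGy] := pselect (good_point y); last first.
  by rewrite /reflect_fun !(memNset nGy).
rewrite {1}/reflect_fun mem_set; last exact: reflect_good.
have [Vy /good_param_refl cy] := Gy; rewrite /reflect_fun mem_set//.
by rewrite (gK (good_param_dom cy)).2 reflK (cK Vy).2.
Qed.

Lemma reflect_preimage A : reflect_fun @^-1` A =
  (good_point `&` c @^-1` (refl m t @^-1` (dom `&` g @^-1` A))) `|`
  (~` good_point `&` A).
Proof.
apply/seteqP; split=> y.
  rewrite /= /reflect_fun; case: ifPn => [/set_mem Gy Ay|/negP nGy Ay].
    left; split=> //; split=> //; apply: good_param_dom.
    by apply: good_param_refl; case: Gy.
  by right; split=> //; apply: contra_not nGy => /mem_set.
by move=> [[Gy [_ Ay]]|[nGy Ay]]; rewrite /= /reflect_fun;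
  [rewrite mem_set|rewrite memNset].
Qed.

Lemma measurable_reflect_fun : measurable_fun setT reflect_fun.
Proof.
move=> _ A mA; rewrite setTI reflect_preimage; have mG := measurable_good_point.
apply: measurableU; apply: measurableI => //; last exact: measurableC.
by apply: mcA; apply: mrA; exact: mg.
Qed.

(** The map is the identity off [good_point]; the part in [good_point] is compared inside [dom],
    where [refl m t] preserves Lebesgue measure. *)
Lemma reflect_fun_preserving A : measurable A ->
  mu (reflect_fun @^-1` A) = mu A.
Proof.
move=> mA; have mG := measurable_good_point.
have mGC : measurable (~` good_point) by exact: measurableC.
have mfA : measurable (reflect_fun @^-1` A).
  by rewrite -[X in measurable X]setTI; exact: measurable_reflect_fun.
have split_mu B : measurable B ->
    mu B = (mu (W `&` (good_point `&` B)) + mu (~` good_point `&` B))%E.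
  move=> mB; rewrite -measureU.
  - congr (mu _); apply/seteqP; split=> y; last by move=> [[_ []]|[]].
    have [Gy By|nGy By] := pselect (good_point y); last by right.
    by left; split; [exact: good_point_sub|].
  - by apply: measurableI => //; exact: measurableI.
  - exact: measurableI.
  - by apply/seteqP; split=> // y [[_ [Gy _]] [/(_ Gy)]].
rewrite (split_mu _ mfA) (split_mu _ mA); congr (_ + mu _)%E; last first.
  apply/seteqP; split=> y [nGy Ay]; split=> //; move: Ay;
    by rewrite /= /reflect_fun memNset.
rewrite -!lebg; try exact: measurableI.
have mGA : measurable (good_param `&` (dom `&` g @^-1` A)).
  by apply: measurableI; [exact: measurable_good_param|exact: mg].
have good_g u : dom u -> good_point (g u) <-> good_param u.
  by move=> du; have [Vg cg] := gK du; rewrite /good_point /= cg; split=> [[]|].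
transitivity (lebesgue_measure (dom `&` (good_param `&` (dom `&` g @^-1` A)))).
  rewrite -(lebesgue_measure_refl t0 mGA).
  congr lebesgue_measure; apply/seteqP; split=> u [du] /=.
    move=> [/(good_g _ du) Gu]; have Gru := good_param_refl Gu.
    rewrite /reflect_fun mem_set; last exact/(good_g _ du).
    rewrite (gK du).2 => Au; do 3!split=> //.
    exact: good_param_dom.
  move=> [/good_param_refl]; rewrite reflK => Gu [_ Au]; split=> //.
  have Gg : good_point (g u) by exact/(good_g _ du).
  by split=> //; rewrite /reflect_fun mem_set// (gK du).2.
congr lebesgue_measure; apply/seteqP; split=> u [du] /=.
  by move=> [/(good_g _ du) Gu [_ Au]].
by move=> [/(good_g _ du)].
Qed.

Definition reflection : mpbij mu :=
  MPBij reflect_funK reflect_funK measurable_reflect_fun measurable_reflect_fun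
    reflect_fun_preserving.

(** The parameters lost are [0], [t], those that [g] sends outside [W], which are null by [lebg],
    and the reflections of the latter. *)
Lemma good_point_conull : mu (W `\` good_point) = 0%E.
Proof.
have mG := measurable_good_point; have mGC := measurableC mG.
have mdW : measurable (dom `&` g @^-1` (~` W)).
  by apply: mg => //; exact: measurableC.
rewrite setDE -lebg//; pose N := [set 0; t] `|` (dom `&` g @^-1` (~` W)) `|`
  (dom `&` refl m t @^-1` (dom `&` g @^-1` (~` W))).
have m0t : measurable ([set 0; t] : set R) by exact: measurableU.
have mrW := mrA mdW.
have N0 : lebesgue_measure N = 0%E.
  have W0 : lebesgue_measure (dom `&` g @^-1` (~` W)) = 0%E.
    by rewrite lebg ?setICr//; exact: measurableC.
  rewrite measureU0; [|exact: measurableU|exact: measurableI|]; last first.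
    by rewrite [LHS](lebesgue_measure_refl t0)// setIA setIid.
  rewrite measureU0//; apply: countable_lebesgue_measure0.
  exact/finite_set_countable/finite_set2.
apply: subset_measure0 N0.
- exact: mg.
- by apply: measurableU; [exact: measurableU|exact: measurableI].
move=> u [du /= nG]; have [Vg cg] := gK du.
have [Wu|nWu] := pselect (W (g u)); last by left; right.
have [Wru|nWru] := pselect (W (g (refl m t u))); last first.
  by right; do 2?split=> //; exact: refl_dom.
left; left; have [uE|u0] := eqVneq u 0; first by left.
have [uE|ut] := eqVneq u t; first by right.
exfalso; apply: nG; split=> //; rewrite /= cg; split=> //.
move: du; rewrite /= in_itv /= => /andP[u0' ->].
by rewrite andbT lt_neqAle eq_sym u0 u0'.
Qed.

End fixed_parameter.

(** At a point good for both parameters, the coordinate of the image determines the parameter by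
    [refl_inj_l]. *)
Lemma reflection_neq t t' (t0 : 0 < t < m) (t'0 : 0 < t' < m) : t != t' ->
  {ae mu, forall y, W y -> reflection t0 y <> reflection t'0 y}.
Proof.
move=> tt'.
have mD s (s0 : 0 < s < m) : measurable (W `\` good_point s).
  by apply: measurableD => //; exact: measurable_good_point.
exists ((W `\` good_point t) `|` (W `\` good_point t')); split.
- by apply: measurableU; exact: mD.
- by rewrite measureU0 ?good_point_conull//; exact: mD.
move=> y /= /not_implyP[Wy /contrapT]; rewrite /reflection /=.
have [Gy|] := pselect (good_point t y); last by left.
have [G'y|] := pselect (good_point t' y); last by right.
rewrite /reflect_fun !mem_set//.
have [Vy Gc] := Gy; have [_ G'c] := G'y.
have dr := good_param_dom (good_param_refl t0 Gc).
have dr' := good_param_dom (good_param_refl t'0 G'c).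
move=> /(congr1 c); rewrite (gK dr).2 (gK dr').2 => rr.
have [c0 ct _ _] := Gc; have [_ ct' _ _] := G'c.
by move: tt'; rewrite (refl_inj_l t0 t'0 c0 ct ct' rr) eqxx.
Qed.

End reflection_family.

Lemma nonatomic_set1 d (T : measurableType d) (R : realType)
    (mu : {measure set T -> \bar R}) (x : T) :
  nonatomic mu -> measurable [set x] -> mu [set x] = 0%E.
Proof.
move=> na mx; apply/eqP; rewrite -measure_le0 leNgt; apply/negP.
move=> /(na _ mx)[B [_ + B0 Bx]] => /subset_set1[BE|BE].
  by move: B0; rewrite BE measure0 ltxx.
by move: Bx; rewrite BE ltxx.
Qed.

Lemma uncountable_itvoo (R : realType) (a b : R) : a < b ->
  ~ countable `]a, b[%classic.
Proof.
move=> ab /countable_lebesgue_measure0.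
rewrite lebesgue_measure_itv /= lte_fin ab => /eqP.
by rewrite -EFinB eqe subr_eq0 gt_eqF.
Qed.

Lemma uncountable_family (R : realType) d (Y : standardBorelType R d)
    (lam : {measure set Y -> \bar R}) (A : set Y) :
  nonatomic lam -> measurable A -> (lam A < +oo)%E ->
  exists W (J : set R) (f : R -> mpbij lam),
    [/\ measurable W, W `<=` A, (lam A <= lam W + lam W)%E & ~ countable J] /\
    [/\ forall t y, ~ W y -> f t y = y &
        forall t t', J t -> J t' -> t != t' ->
          {ae lam, forall y, W y -> f t y <> f t' y}].
Proof.
move=> na mA Afin.
have [A0|A0] := eqVneq (lam A) 0%E.
  (* For null [A] the empty set serves as [W], and a constant family differs everywhere on it
     vacuously. *)
  exists set0, `]0, 1[%classic, (fun=> mpbij_one lam); split; split => //.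
  - by rewrite A0 measure0 adde0.
  - exact: uncountable_itvoo.
  - by move=> *; exact: nearW.
have [U [genU sepU tightU]] := standard_borel_base Y.
have Af : lam A \is a fin_num by rewrite ge0_fin_numE.
pose a := fine (lam A); have aE : lam A = a%:E by rewrite fineK.
have a0 : 0 < a by rewrite -lte_fin -aE lt_neqAle eq_sym A0 measure_ge0.
(* Losing at most half of the mass gives the bound [lam A <= lam W + lam W]. *)
have [|X [mX AX cX]] := tightU lam A (a / 2) mA Afin; first by rewrite divr_gt0.
pose W := A `&` X; have mW : measurable W by exact: measurableI.
have WA : W `<=` A by move=> y [].
have Wfin : (lam W < +oo)%E.
  by apply: le_lt_trans Afin; apply: le_measure; rewrite ?inE.
have mD : measurable (A `\` X) by exact: measurableD.
have AW : (lam A <= lam W + (a / 2)%:E)%E.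
  by rewrite (measureDI lam mA mX) addeC leeD2l.
have Wf : lam W \is a fin_num by rewrite ge0_fin_numE.
pose m := wt W lam setT; have mE : lam W = m%:E by exact: massE.
have m0 : a / 2 <= m by move: AW; rewrite aE mE -EFinD lee_fin; lra.
have lam1 x : lam [set x] = 0%E.
  apply: nonatomic_set1 => //.
  have -> : [set x] = \bigcap_i (if `[< U i x >] then U i else ~` U i).
    apply/seteqP; split=> [_ -> i _|y xy]; first by case: asboolP.
    by apply: sepU => i; have := xy i I; case: asboolP.
  apply: bigcapT_measurable => i; have mU := measurable_U genU i.
  by case: ifP => // _; exact: measurableC.
have [g [c [V [[mV mc mg] [gK cK lebg]]]]] :=
  interval_coding genU sepU cX mW (@subIsetr _ A X) Wfin lam1.
(* The identity is the default value for parameters outside []0, m[]. *)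
exists W, `]0, m[%classic,
  (fun t => if asboolP (0 < t < m) is ReflectT h
     then reflection mW mV mc mg gK cK lebg h else mpbij_one lam).
split; split => //.
- by rewrite aE mE -EFinD lee_fin; lra.
- by apply: uncountable_itvoo; lra.
- move=> t y nWy; case: asboolP => // h; exact: reflect_id.
- move=> t t'; rewrite /= !in_itv => tm t'm tt'.
  case: asboolP => // h; case: asboolP => // h'; exact: reflection_neq.
Qed.

(** * Uncountable families in Polish groups *)

Lemma uncountable_collision (T : Type) (J : set T) (h : T -> nat) :
  ~ countable J -> exists t t', [/\ J t, J t', t <> t' & h t = h t'].
Proof.
move=> nJ; apply: contrapT => H; apply: nJ; apply/countable_injP.
exists h => t t'; rewrite !inE => Jt Jt' tt'; apply: contrapT => ntt'.
by apply: H; exists t, t'.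
Qed.

Lemma dist_cvg_unique (R : realType) (X : topologicalType) (dist : X -> X -> R)
    (u : nat -> X) (l l' : X) :
  is_distance dist -> induces_topology dist ->
  u @ \oo --> l -> u @ \oo --> l' -> l = l'.
Proof.
move=> [d0 dE dC dT] dN ul ul'; apply/dE/eqP; rewrite eq_le d0 andbT leNgt.
apply/negP => ll'; have [|N NP] := cvg_dist (e := dist l l' / 2) dN ul.
  by rewrite divr_gt0.
have [|N' N'P] := cvg_dist (e := dist l l' / 2) dN ul'.
  by rewrite divr_gt0.
pose n := maxn N N'; have h := NP n (leq_maxl _ _).
have h' := N'P n (leq_maxr _ _); have := dT l (u n) l'.
by rewrite leNgt (dC (u n)) [ltRHS]splitr ltrD.
Qed.

Section topological_group.
Context (R : realType) (G : groupType) (tau : topology G).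
Hypothesis tauG : group_topology tau.

Let mul (x y : topspace tau) : topspace tau := ((x : G) * (y : G))%g.
Let inv (x : topspace tau) : topspace tau := ((x : G)^-1)%g.

Lemma group_cvgM T (F : set_system T) {FF : Filter F} (f g : T -> topspace tau)
    (a b : topspace tau) :
  f @ F --> a -> g @ F --> b -> (fun x => mul (f x) (g x)) @ F --> mul a b.
Proof.
by move=> fa gb; exact: (cvg_comp2 (h := mul) fa gb (tauG.1 (a, b))).
Qed.

Lemma group_cvgV T (F : set_system T) {FF : Filter F} (f : T -> topspace tau)
    (a : topspace tau) : f @ F --> a -> (fun x => inv (f x)) @ F --> inv a.
Proof. by move=> fa; exact: (cvg_comp _ _ fa (tauG.2 a)). Qed.

Variable dist : topspace tau -> topspace tau -> R.
Hypotheses (dP : is_distance dist) (dN : induces_topology dist).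

(** Continuity of [(y, z) |-> P * (y / z)] at [(x, x)], where its value is [P], gives a radius
    around each [x] within which pairs are good. Uncountability supplies two members of the family
    within such a radius. *)
Lemma uncountable_close_pair (T : Type) (J : set T) (f : T -> G) (P : G)
    (e : R) :
  separable (topspace tau) -> ~ countable J -> 0 < e ->
  exists t t', [/\ J t, J t', t <> t' & dist P (P * (f t / f t'))%g < e].
Proof.
move=> [D cD dD] nJ e0; have [d0 dE dC dT] := dP.
have [D0|/unsquash q] := pfcard_geP cD.
  have /(dD setT) : [set: topspace tau] !=set0 by exists P.
  by move=> /(_ openT)[x [_]]; rewrite D0.
have near_q x (r : R) : 0 < r -> exists k, dist (q k) x < r.
  move=> r0; have [||y [/= xy Dy]] := dD [set y | dist x y < r].
  - by exists x; rewrite /= (iffRL (dE x x) erefl).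
  - rewrite openE => y /= xy; apply/dN; exists (r - dist x y).
      by rewrite subr_gt0.
    by move=> z /=; rewrite ltrBrDl; apply: le_lt_trans; exact: dT.
  - by have [k _ kx] := 'surj_q Dy; exists k; rewrite kx dC.
have radius x : exists n, forall y z, dist x y < n.+1%:R^-1 ->
    dist x z < n.+1%:R^-1 -> dist P (P * (y / z))%g < e.
  have c : (fun p : topspace tau * topspace tau => mul P (mul p.1 (inv p.2))) @
      nbhs ((x : topspace tau), (x : topspace tau)) --> mul P (mul x (inv x)).
    apply: group_cvgM; first exact: cvg_cst.
    by apply: group_cvgM; [exact: cvg_fst|apply: group_cvgV; exact: cvg_snd].
  have PE : mul P (mul x (inv x)) = P by rewrite /mul /inv mulgV mulg1.
  have /c[[A B] [/= /dN[a a0 aA] /dN[b b0 bB]] AB] :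
      nbhs (mul P (mul x (inv x))) [set y | dist P y < e].
    by rewrite PE; apply/dN; exists e.
  have [n] : exists n, n.+1%:R^-1 < Num.min a b.
    have ab0 : 0 < Num.min a b by rewrite lt_min a0.
    have [n _ /(_ n (leqnn n))] := near_infty_natSinv_lt (PosNum ab0).
    by exists n.
  rewrite lt_min => /andP[na nb]; exists n => y z xy xz.
  apply: (AB (y, z)); split=> /=.
    by apply: aA; exact: lt_trans na.
  by apply: bB; exact: lt_trans nb.
have [n nP] := choice radius.
have [t|k kP] := choice (_ : forall t, exists k,
    dist (q k) (f t) < (n (f t)).+1%:R^-1 / 2).
  by apply: near_q; rewrite divr_gt0// invr_gt0.
(* Each parameter is coloured by its radius and by a dense point within half that radius of [f t].
   Two parameters of one colour have images closer than the common radius. *)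
have [t [t' [Jt Jt' tt' /(pcan_inj pickleK)[nE kE]]]] :=
  uncountable_collision (fun t => pickle (n (f t), k t)) nJ.
exists t, t'; split=> //; apply: (nP (f t)).
  by rewrite (iffRL (dE _ _) erefl) invr_gt0.
apply: le_lt_trans (dT _ (q (k t)) _) _; rewrite dC [ltRHS]splitr.
by apply: ltrD => //; rewrite kE nE.
Qed.

End topological_group.

(** * Centralizers in the group of finitely supported bijections *)

Section finite_support.
Context (R : realType) d (Y : standardBorelType R d).
Variable lam : {measure set Y -> \bar R}.
Local Open Scope quotient_scope.
Implicit Types (S T Q : mpbij lam) (W : set Y).

Definition supported W T := forall y, ~ W y -> T y = y.

(** If [T y] were outside [W], it would be fixed by [T], and injectivity would give [T y = y]. *)
Lemma supported_stable W T y : supported W T -> W y -> W (T y).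
Proof.
move=> TW Wy; apply: contrapT => nWT; have := TW _ nWT.
by move=> /(can_inj (mpbijK T)) Ty; rewrite Ty in nWT.
Qed.

Lemma supported_inverse W T : supported W T -> supported W (mpbij_inverse T).
Proof. by move=> TW y nWy /=; rewrite -{1}(TW _ nWy) mpbijK. Qed.

Lemma supported_comp W S T :
  supported W S -> supported W T -> supported W (mpbij_comp S T).
Proof. by move=> SW TW y nWy /=; rewrite TW// SW. Qed.

Lemma finite_supp_supported W T : measurable W -> (lam W < +oo)%E ->
  supported W T -> (lam (supp T) < +oo)%E.
Proof.
move=> mW Wfin TW; apply: le_lt_trans Wfin; apply: le_measure; rewrite ?inE//.
  exact: measurable_supp.
by move=> y /eqP Ty; apply: contrapT => /(TW _).
Qed.

(* Junk value [1] when the support of [T] has infinite measure. *)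
Definition autf T : Autf lam := insubd (1%g : Autf lam) (\pi_(Aut lam) T).

Lemma val_autf T : (lam (supp T) < +oo)%E -> val (autf T) = \pi_(Aut lam) T.
Proof. by move=> Tfin; rewrite /autf insubdK// finite_suppE. Qed.

Lemma autf_comp S T : (lam (supp S) < +oo)%E -> (lam (supp T) < +oo)%E ->
  (lam (supp (mpbij_comp S T)) < +oo)%E /\
  autf (mpbij_comp S T) = (autf S * autf T)%g.
Proof.
move=> Sfin Tfin.
have E : \pi_(Aut lam) (mpbij_comp S T) = val (autf S * autf T)%g.
  by rewrite [RHS]valM !val_autf// -Aut_mulE.
have fin : (lam (supp (mpbij_comp S T)) < +oo)%E.
  by rewrite -finite_suppE E; exact: valP.
by split=> //; apply: val_inj; rewrite val_autf.
Qed.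

Lemma autf_inverse T : (lam (supp T) < +oo)%E ->
  (lam (supp (mpbij_inverse T)) < +oo)%E /\
  autf (mpbij_inverse T) = (autf T)^-1%g.
Proof.
move=> Tfin.
have E : \pi_(Aut lam) (mpbij_inverse T) = val ((autf T)^-1)%g.
  have -> : val ((autf T)^-1)%g = ((val (autf T))^-1)%g by exact: gmulfV.
  by rewrite val_autf// -Aut_invE.
have fin : (lam (supp (mpbij_inverse T)) < +oo)%E.
  by rewrite -finite_suppE E; exact: valP.
by split=> //; apply: val_inj; rewrite val_autf.
Qed.

Lemma autf_surj (g : Autf lam) :
  exists Q, (lam (supp Q) < +oo)%E /\ g = autf Q.
Proof.
have gfin : (lam (supp (repr (val g))) < +oo)%E by have := valP g.
exists (repr (val g)); split=> //; apply: val_inj.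
by rewrite val_autf// reprK.
Qed.

Lemma autf_eqP S T : (lam (supp S) < +oo)%E -> (lam (supp T) < +oo)%E ->
  autf S = autf T <-> {ae lam, forall y, S y = T y}.
Proof.
move=> Sfin Tfin; rewrite -Aut_eqP -!val_autf//.
by split=> [->//|/val_inj].
Qed.

(* If [Q] moves [B] off itself, a map supported in [B] commuting with [Q] is
   trivial; since [B] supports nontrivial maps unless it is null, an element of
   the centralizer cannot move a set of positive measure. *)
Lemma centralizer_trivial W Q :
  nonatomic lam -> measurable W -> (lam W < +oo)%E ->
  (forall U, supported W U -> {ae lam, forall y, Q (U y) = U (Q y)}) ->
  {ae lam, forall y, W y -> Q y = y}.
Proof.
move=> na mW Wfin comm.
have null B : measurable B -> B `<=` W -> (forall y, B y -> ~ B (Q y)) ->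
    lam.-negligible B.
  move=> mB BW BQ.
  have [|W' [J [f [[mW' W'B BW' nJ] [fid fneq]]]]] := uncountable_family na mB.
    by apply: le_lt_trans Wfin; apply: le_measure; rewrite ?inE.
  (* A constant colouring simply extracts two distinct parameters. *)
  have [t [t' [Jt Jt' /eqP tt' _]]] := uncountable_collision (fun=> 0%N) nJ.
  have fsupp s : supported W (f s).
    by move=> y nWy; apply: fid => /W'B/BW.
  have W'0 : lam.-negligible W'.
    have : {ae lam, forall y, ~ W' y}.
      (* For [y] in [W'], the point [Q y] is outside [W'], so [f t] and [f t'] fix it. Commutation
         gives [Q (f t y) = Q y = Q (f t' y)], although [f t y] and [f t' y] differ. *)
      apply: filterS3 (comm _ (fsupp t)) (comm _ (fsupp t'))
        (fneq _ _ Jt Jt' tt').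
      move=> y ct ct' ne W'y; apply: (ne W'y).
      have nW'Q : ~ W' (Q y) by move=> /W'B; apply: BQ; exact: W'B.
      apply: (can_inj (mpbijK Q)); rewrite ct ct'.
      by rewrite !fid.
    by apply: negligibleS => y W'y /=; apply.
  apply/negligibleP => //; apply/eqP; rewrite -measure_le0.
  by apply: le_trans BW' _; move/negligibleP: W'0 => /(_ mW') ->; rewrite adde0.
have [U [genU sepU _]] := standard_borel_base Y.
have mU i : measurable (U i) by exact: measurable_U.
have mQ A : measurable A -> measurable (Q @^-1` A).
  exact: measurable_mpbij_preimage.
(* As [U] separates points, every point of [W] moved by [Q] lies in some [B1 i] or [B2 i], and [Q]
   moves each of these sets off itself. *)
pose B1 i := W `&` (U i `\` (Q @^-1` U i)).
pose B2 i := W `&` ((Q @^-1` U i) `\` U i).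
have : lam.-negligible (\bigcup_i (B1 i `|` B2 i)).
  apply: negligible_bigcup => i; apply: negligibleU; apply: null.
  - by apply: measurableI => //; apply: measurableD => //; exact: mQ.
  - by move=> y [].
  - by move=> y [_ [_ nU]] [_ []].
  - by apply: measurableI => //; apply: measurableD => //; exact: mQ.
  - by move=> y [].
  - by move=> y [_ [QU _]] [_ [_]].
apply: negligibleS => y /= /not_implyP[Wy Qy]; apply: contrapT => nB.
apply: Qy; apply: sepU => i.
split=> Uy; apply: contrapT => nU; apply: nB; exists i => //.
  by right.
by left.
Qed.

End finite_support.

(** For large [k] the inverse of [T] composed with [p k] is trivial on [W], so it commutes with
    every map supported in [W]. The limit [H] inherits this, and [centralizer_trivial] applies to
    it. *)
Lemma limit_fixes (R : realType) d (Y : standardBorelType R d)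
    (lam : {measure set Y -> \bar R}) (tau : topology (Autf lam))
    (dist : topspace tau -> topspace tau -> R)
    (W : set Y) (T Q : mpbij lam) (p : nat -> mpbij lam) :
  nonatomic lam -> group_topology tau ->
  is_distance dist -> induces_topology dist ->
  measurable W -> (lam W < +oo)%E ->
  supported W T -> (lam (supp Q) < +oo)%E ->
  (forall k, (lam (supp (p k)) < +oo)%E) ->
  (\forall k \near \oo, forall y, W y -> p k y = T y) ->
  (fun k => autf (p k) : topspace tau) @ \oo --> (autf Q : topspace tau) ->
  {ae lam, forall y, W y -> Q y = T y}.
Proof.
move=> na tauG dP dN mW Wfin TW Qfin pfin pT pQ.
have Tfin := finite_supp_supported mW Wfin TW.
have [Vfin VE] := autf_inverse Tfin.
pose H := mpbij_comp (mpbij_inverse T) Q.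
suff : {ae lam, forall y, W y -> H y = y}.
  by apply: filterS => y /= Hy Wy; rewrite -{2}(Hy Wy) mpbijVK.
apply: (centralizer_trivial na mW Wfin) => U UW.
have Ufin := finite_supp_supported mW Wfin UW.
pose h k := mpbij_comp (mpbij_inverse T) (p k).
have [Hfin HE] := autf_comp Vfin Qfin.
have hfin k := (autf_comp Vfin (pfin k)).1.
have hE k := (autf_comp Vfin (pfin k)).2.
pose mul (x y : topspace tau) : topspace tau :=
  ((x : Autf lam) * (y : Autf lam))%g.
pose u : topspace tau := autf U.
pose v : topspace tau := autf (mpbij_inverse T).
have hH : (fun k => autf (h k) : topspace tau) @ \oo --> (autf H : topspace tau).
  have -> : (autf H : topspace tau) = mul v (autf Q) by exact: HE.
  have -> : (fun k => autf (h k) : topspace tau) = fun k => mul v (autf (p k)).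
    by apply/funext => k; exact: hE.
  exact: (group_cvgM tauG (cvg_cst v) pQ).
have hu : (fun k => mul (autf (h k)) u) @ \oo --> mul (autf H) u.
  exact: (group_cvgM tauG hH (cvg_cst u)).
have uh : (fun k => mul u (autf (h k))) @ \oo --> mul u (autf H).
  exact: (group_cvgM tauG (cvg_cst u) hH).
have comm : \forall k \near \oo, mul u (autf (h k)) = mul (autf (h k)) u.
  apply: filterS pT => k pkT; rewrite /mul /u.
  rewrite -(autf_comp Ufin (hfin k)).2 -(autf_comp (hfin k) Ufin).2.
  apply/autf_eqP.
  - exact: (autf_comp Ufin (hfin k)).1.
  - exact: (autf_comp (hfin k) Ufin).1.
  apply: nearW => y /=; have [Wy|nWy] := pselect (W y).
    by rewrite !pkT ?mpbijK//; exact: supported_stable.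
  (* Being injective and fixing [W] pointwise, [h k] cannot send a point outside [W] into [W]. *)
  rewrite (UW y nWy) UW// => Wz; apply: nWy.
  have := pkT _ Wz; rewrite /= mpbijVK => /(can_inj (mpbijK (p k))) zy.
  by rewrite -zy.
have : mul u (autf H) = mul (autf H) u.
  apply: (dist_cvg_unique dP dN uh).
  by apply: cvg_trans hu; apply: near_eq_cvg; apply: filterS comm => k ->.
rewrite /mul /u -(autf_comp Ufin Hfin).2 -(autf_comp Hfin Ufin).2.
move/autf_eqP => /(_ (autf_comp Ufin Hfin).1 (autf_comp Hfin Ufin).1).
by apply: filterS => y /= ->.
Qed.

(** * The infinite product and the contradiction *)

Theorem theorem2p9 (R : realType) (d : measure_display)
    (Y : standardBorelType R d) (lam : {sigma_finite_measure set Y -> \bar R})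
    (lam_nonatomic : nonatomic lam) (lam_infinite : lam [set: Y] = +oo%E) :
  ~ exists tau : topology (Autf lam),
      polish R (topspace tau) /\ group_topology tau.
Proof.
move=> [tau [[sep [dist [dP dN dcomp]]] tauG]].
have [F FT mF] := sigma_finiteT lam.
pose A := seqDU F.
have mA k : measurable (A k).
  apply: measurableD; first exact: (mF k).1.
  by apply: bigsetU_measurable => i _; exact: (mF i).1.
have Afin k : (lam (A k) < +oo)%E.
  apply: le_lt_trans (mF k).2; apply: le_measure; rewrite ?inE//.
    exact: (mF k).1.
  by move=> y [].
have tA : trivIset setT A := trivIset_seqDU F.
have [W WP] := choice (fun k =>
  uncountable_family lam_nonatomic (mA k) (Afin k)).
have mW k : measurable (W k) by have [J [f [[]]]] := WP k.
have WA k : W k `<=` A k by have [J [f [[]]]] := WP k.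
have AW k : (lam (A k) <= lam (W k) + lam (W k))%E by have [J [f [[]]]] := WP k.
have Wfin k : (lam (W k) < +oo)%E.
  by apply: le_lt_trans (Afin k); apply: le_measure; rewrite ?inE.
have disjW j k y : W j y -> W k y -> j = k.
  by move=> /WA Aj /WA Ak; apply: tA => //; exists y.
have [h [h0 hd hs]] : exists h : nat -> R, [/\ forall k, 0 < h k,
    forall k, h k.+1 < h k & forall e, 0 < e -> exists N, h N < e].
  exists (fun k => k.+1%:R^-1); split=> [k|k|e e0].
  - by rewrite invr_gt0.
  - by rewrite ltf_pV2 ?posrE// ltr_nat.
  - have [N _ /(_ N (leqnn N))] := near_infty_natSinv_lt (PosNum e0).
    by exists N.
have hd0 k : 0 < h k - h k.+1 by rewrite subr_gt0.
(* The choice depends on the current product, since [dist] is not assumed invariant. The bounds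
   [h k - h k.+1] telescope. *)
have [step stepP] : {step : nat * mpbij lam -> mpbij lam | forall kS,
    [/\ supported (W kS.1) (step kS),
        {ae lam, forall y, W kS.1 y -> step kS y <> y} &
        dist (autf kS.2) (autf kS.2 * autf (step kS))%g < h kS.1 - h kS.1.+1]}.
  suff /choice[step stepP] : forall kS : nat * mpbij lam, exists T,
    [/\ supported (W kS.1) T, {ae lam, forall y, W kS.1 y -> T y <> y} &
        dist (autf kS.2) (autf kS.2 * autf T)%g < h kS.1 - h kS.1.+1].
    by exists step.
  move=> [k S] /=; have [J [f [[_ _ _ nJ] [fid fneq]]]] := WP k.
  have fW t : supported (W k) (f t) by move=> y; exact: fid.
  have ffin t := finite_supp_supported (mW k) (Wfin k) (fW t).
  have [t [t' [Jt Jt' /eqP tt' tS]]] := uncountable_close_pair tauG dP dN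
    (fun t => autf (f t)) (autf S) sep nJ (hd0 k).
  have [Vfin VE] := autf_inverse (ffin t').
  have [_ CE] := autf_comp (ffin t) Vfin.
  exists (mpbij_comp (f t) (mpbij_inverse (f t'))); split.
  - exact: supported_comp (fW t) (supported_inverse (fW t')).
  (* The inequality of [f t] and [f t'] is used at the preimage of [y] under [f t'], which stays in
     [W k]. *)
  - apply: filterS (ae_mpbij (mpbij_inverse (f t')) (fneq _ _ Jt Jt' tt')) => y.
    move=> ne Wy /= ffy; apply: ne; last by rewrite mpbijVK.
    exact: (supported_stable (supported_inverse (fW t'))).
  - by rewrite CE VE.
pose fix p k := if k is k'.+1 then mpbij_comp (p k') (step (k', p k'))
  else mpbij_one lam.
pose s k := step (k, p k).
have sW k : supported (W k) (s k) by have [] := stepP (k, p k).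
have sfin k := finite_supp_supported (mW k) (Wfin k) (sW k).
have pfin k : (lam (supp (p k)) < +oo)%E.
  elim: k => [|k IHk] /=; last exact: (autf_comp IHk (sfin k)).1.
  rewrite (_ : supp _ = set0) ?measure0//.
  by apply/seteqP; split=> y //; rewrite /supp /= eqxx.
(* The sets [W j] are disjoint and stable under the factors, so only the factor [s j] acts on [W j],
   and it is present from [p j.+1] on. *)
have pE k j y : W j y -> p k y = if (j < k)%N then s j y else y.
  elim: k y => [//|k IHk] y Wy /=; rewrite ltnS leq_eqVlt.
  have [jk|jk] := eqVneq j k.
    subst k; rewrite IHk ?ltnn//; exact: supported_stable.
  rewrite [step _ y](sW k) ?IHk// => Wky.
  by move/eqP: jk; apply; exact: disjW Wy Wky.
have [d0 dE dC dT] := dP.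
have pdist N i : dist (autf (p N)) (autf (p (N + i)%N)) <= h N - h (N + i)%N.
  elim: i => [|i IHi]; first by rewrite addn0 subrr (iffRL (dE _ _) erefl).
  rewrite addnS /= (autf_comp (pfin _) (sfin _)).2.
  have [_ _ /ltW ds] := stepP ((N + i)%N, p (N + i)%N).
  apply: le_trans (dT _ (autf (p (N + i)%N)) _) _.
  by apply: le_trans (lerD IHi ds) _; rewrite /= addrA subrK.
have [|g pg] := dcomp (fun k => autf (p k) : topspace tau).
  move=> e e0; have [|N Ne] := hs (e / 2); first by rewrite divr_gt0.
  have pN k : (N <= k)%N -> dist (autf (p N)) (autf (p k)) < e / 2.
    move=> /subnKC <-; apply: le_lt_trans (pdist N _) _.
    by apply: lt_trans Ne; rewrite ltrBlDr ltrDl.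
  exists N => m n Nm Nn; apply: le_lt_trans (dT _ (autf (p N)) _) _.
  by rewrite [ltRHS]splitr dC ltrD ?pN.
have [Q [Qfin gE]] := autf_surj g; rewrite {g}gE in pg.
have Qs j : {ae lam, forall y, W j y -> Q y = s j y}.
  apply: (limit_fixes lam_nonatomic tauG dP dN (mW j) (Wfin j) (sW j) Qfin
    pfin _ pg).
  by exists j.+1 => // k /= jk y Wy; rewrite (pE k j y Wy) jk.
have mQ := measurable_supp Q.
(* On [W j] the limit [Q] agrees almost everywhere with [s j], which moves almost every point
   there. *)
have WQ j : lam (W j) = lam (W j `&` supp Q).
  rewrite (measureDI lam (mW j) mQ) [X in (X + _)%E](_ : _ = 0%E) ?add0e//.
  apply/negligibleP; first exact: measurableD.
  have [_ sneq _] := stepP (j, p j).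
  have : {ae lam, forall y, ~ (W j `\` supp Q) y}.
    apply: filterS2 (Qs j) sneq => y Qy sy [Wy] /=; apply.
    by rewrite /supp /= Qy//; apply/eqP; exact: sy.
  by apply: negligibleS => y Wy /=; apply.
have sum_fin : (\sum_(j <oo) lam (W j) < +oo)%E.
  rewrite (eq_eseriesr (fun j _ => WQ j)) -measure_semi_bigcup.
  - apply: le_lt_trans Qfin; apply: le_measure; rewrite ?inE//.
      by apply: bigcupT_measurable => j; exact: measurableI.
    by move=> y [j _ []].
  - by move=> j; exact: measurableI.
  - by move=> j k _ _ [y [[Wj _] [Wk _]]]; exact: disjW Wj Wk.
  - by apply: bigcupT_measurable => j; exact: measurableI.
(* Since [A j] has at most twice the measure of [W j], the finite sum would bound the measure of all
   of [Y]. *)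
have : (lam (\bigcup_j A j) < +oo)%E.
  rewrite measure_semi_bigcup//; last exact: bigcupT_measurable.
  apply: le_lt_trans (lee_nneseries _ (fun j _ => AW j)) _ => //.
  by rewrite nneseriesD// lte_add_pinfty.
by rewrite -seqDU_bigcup_eq -FT lam_infinite.
Qed.
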